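(* The Pareto Like mechanism returns only and all Pareto efficient ex post allocations: for each instance with $m\in\mathbb{N}$ items, an allocation $\pi_m\in\Pi_m$ is returned by the Pareto Like mechanism with positive probability if and only if $\pi_m$ is Pareto efficient ex post.
   Context: Setting. An online fair division instance consists of a set of agents $N=\{1,\ldots,n\}$, an ordered set of indivisible items $O=\{o_1,\ldots,o_m\}$, and sincere utilities $u_{ij}\in\mathbb{R}_{\ge 0}$ of each agent $i\in N$ for each item $o_j$. It is supposed that at least one agent has positive utility for every item (otherwise the item can simply be discarded). Item $o_j$ arrives at round $j$, and each agent $i$ places a bid for it; agents are supposed to bid sincerely, i.e. agent $i$ bids $u_{ij}$ for $o_j$. An allocation $\pi_j$ of $o_1,\ldots,o_j$ gives a bundle $\pi_{ji}$ to each agent $i$, with the bundles pairwise disjoint and with union $\{o_1,\ldots,o_j\}$; $\Pi_j$ is the set of all such allocations. Utilities are additive: $u_i(\pi_j)=\sum_{o_h\in\pi_{ji}}u_{ih}$. An allocation $\pi_j\in\Pi_j$ is Pareto efficient ex post if there is no $\pi'_j\in\Pi_j$ such that $u_i(\pi'_j)\ge u_i(\pi_j)$ for all $i\in N$ and $u_k(\pi'_j)>u_k(\pi_j)$ for some $k\in N$. Pareto Like mechanism: items are allocated one by one in the order $o_1,\ldots,o_m$. At round $j$, given the allocation $\pi_{j-1}\in\Pi_{j-1}$ of the earlier items, agent $i$ is feasible for $o_j$ if the allocation in $\Pi_j$ extending $\pi_{j-1}$ by allocating $o_j$ to $i$ is Pareto efficient ex post; the item $o_j$ is then given to an agent chosen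 uniformly at random among the feasible agents. The probability of an allocation is the product of these conditional probabilities over the rounds. *)

(* Defs.v *)
From mathcomp Require Import all_boot all_order all_algebra.

Set Implicit Arguments.
Unset Strict Implicit.
Unset Printing Implicit Defensive.

Import Order.TTheory GRing.Theory Num.Theory.
Local Open Scope ring_scope.

(* Agents are 'I_n and items 'I_m, in order of arrival; ordinals start at 0,
   so item o arrives when exactly the o items o' < o have been allocated.
   Partial allocations share one carrier type: the index j of Pi_j is the
   argument j of [allocations]. *)
Definition bundles (n m : nat) : finType := {ffun 'I_n -> {set 'I_m}}.

Definition first_items (m j : nat) : {set 'I_m} := [set o : 'I_m | (o < j)%N].

Definition allocations (n m j : nat) : {set bundles n m} :=
  [set p : bundles n m |
     [forall i, forall k, (i != k) ==> [disjoint p i & p k]]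
     && (\bigcup_(i < n) p i == first_items m j)].

Section Mechanism.
Variables (R : realFieldType) (n m : nat) (u : 'I_n -> 'I_m -> R).

Definition utility (i : 'I_n) (p : bundles n m) : R := \sum_(o in p i) u i o.

Definition pareto_dominates (p' p : bundles n m) : bool :=
  [forall i, utility i p <= utility i p']
  && [exists k, utility k p < utility k p'].

Definition pareto_efficient (j : nat) (p : bundles n m) : bool :=
  ~~ [exists p' in allocations n m j, pareto_dominates p' p].

Definition give (p : bundles n m) (o : 'I_m) (i : 'I_n) : bundles n m :=
  [ffun k => if k == i then o |: p k else p k].

(* Bids are sincere, so feasibility is computed from the utilities. *)
Definition feasible (p : bundles n m) (o : 'I_m) : {set 'I_n} :=
  [set i | pareto_efficient o.+1 (give p o i)].

(* Probability that the round of item o, started at p, ends at q, when the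
   receiver of o is uniform over the feasible agents. *)
Definition round_prob (p : bundles n m) (o : 'I_m) (q : bundles n m) : R :=
  \sum_(i in feasible p o | give p o i == q) (#|feasible p o|%:R)^-1.

Definition restrict (j : nat) (p : bundles n m) : bundles n m :=
  [ffun i => p i :&: first_items m j].

(* Since allocated items are never moved, the only run that can end at p goes
   through the restrictions of p to the items that arrived so far. *)
Definition pareto_like_prob (p : bundles n m) : R :=
  \prod_(o < m) round_prob (restrict o p) o (restrict o.+1 p).

End Mechanism.

(* Main.v *)
(** Efficiency is inherited by restrictions: if some allocation dominated the
    restriction of [p] to the first items, completing it by the remaining part
    of [p] would dominate [p], by additivity.  So every round of the run leading
    to an efficient allocation has positive probability; conversely, the last
    round only returns efficient allocations. *)
Require Import Defs.
From mathcomp Require Import all_boot all_order all_algebra.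

Set Implicit Arguments.
Unset Strict Implicit.
Unset Printing Implicit Defensive.

Import Order.TTheory GRing.Theory Num.Theory.
Local Open Scope ring_scope.

Lemma allocationsP (n m j : nat) (p : bundles n m) :
  reflect ((forall i k, i != k -> [disjoint p i & p k]) /\
           \bigcup_(i < n) p i = first_items m j)
          (p \in allocations n m j).
Proof.
rewrite inE; apply: (iffP andP) => -[p_disj p_cover]; split.
- by move=> i k neq_ik; move/forallP/(_ i)/forallP/(_ k)/implyP: p_disj; apply.
- exact/eqP.
- by apply/forallP => i; apply/forallP => k; apply/implyP; apply: p_disj.
- exact/eqP.
Qed.

Lemma allocations_sub (n m j : nat) (p : bundles n m) (i : 'I_n) :
  p \in allocations n m j -> p i \subset first_items m j.
Proof. by case/allocationsP => _ <-; apply: bigcup_sup. Qed.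

Lemma restrict_allocation (n m j : nat) (p : bundles n m) :
  p \in allocations n m j -> restrict j p = p.
Proof.
by move=> p_alloc; apply/ffunP => i; rewrite ffunE; apply/setIidPl/allocations_sub.
Qed.

(** Disjointness makes [i] the only owner of [o], so passing from the items before [o] to those up
    to [o] changes the bundle of [i] alone. This identifies the steps of the mechanism along [p]. *)
Lemma give_restrict (n m : nat) (p : bundles n m) (o : 'I_m) (i : 'I_n) :
  p \in allocations n m m -> o \in p i ->
  give (restrict o p) o i = restrict o.+1 p.
Proof.
case/allocationsP => p_disj _ o_pi; apply/ffunP => k; rewrite !ffunE.
have o_pk : (o \in p k) = (k == i).
  case: eqVneq => [-> //|neq_ki]; apply/negbTE.
  by rewrite (disjointFl (p_disj k i neq_ki) o_pi).
apply/setP => x; have [->|neq_xo] := eqVneq x o.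
  by case: ifP o_pk => _ o_pk; rewrite !inE ?eqxx o_pk ?ltnS ?leqnn.
(* For an item other than [o], the cutoffs [x < o] and [x <= o] agree. *)
have neq_val : (x == o :> nat) = false := negbTE neq_xo.
by case: ifP => _; rewrite !inE ?(negbTE neq_xo) /= ltnS (leq_eqVlt x o) neq_val.
Qed.

Section Completion.
Variables (R : realFieldType) (n m j : nat) (u : 'I_n -> 'I_m -> R).

Definition complete (p q : bundles n m) : bundles n m :=
  [ffun i => q i :|: (p i :\: first_items m j)].

(** Bundles of [q] hold only items before [j], and the part kept from [p] only later ones, so two
    bundles could meet only within [q] or within [p]. An item is covered by [q] or by [p] according
    to its arrival. *)
Lemma complete_allocation (p q : bundles n m) :
  p \in allocations n m m -> q \in allocations n m j ->
  complete p q \in allocations n m m.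
Proof.
move=> /allocationsP[p_disj p_cover] q_alloc.
have q_sub i x : x \in q i -> (x < j)%N.
  by move/(subsetP (allocations_sub i q_alloc)); rewrite inE.
have [q_disj q_cover] := allocationsP _ _ q_alloc.
apply/allocationsP; split=> [i k neq_ik|].
  rewrite disjoint_subset; apply/subsetP => x; rewrite !inE !ffunE !inE.
  case/orP => [x_qi|/andP[x_late x_pi]].
    by rewrite (disjointFr (q_disj _ _ neq_ik) x_qi) (q_sub i x x_qi).
  rewrite (disjointFr (p_disj _ _ neq_ik) x_pi) andbF orbF.
  by apply: contra x_late; apply: q_sub.
apply/setP => x; rewrite [RHS]inE ltn_ord; apply/bigcupP.
have [x_early|x_late] := ltnP x j.
  have : x \in \bigcup_(i < n) q i by rewrite q_cover inE.
  by case/bigcupP => i _ x_qi; exists i; rewrite // ffunE inE x_qi.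
have : x \in \bigcup_(i < n) p i by rewrite p_cover inE.
case/bigcupP => i _ x_pi; exists i; rewrite // ffunE !inE x_pi.
by rewrite -leqNgt x_late orbT.
Qed.

Lemma utility_split (i : 'I_n) (p : bundles n m) :
  utility u i p =
    utility u i (restrict j p) + \sum_(o in p i :\: first_items m j) u i o.
Proof. by rewrite /utility (big_setID (first_items m j)) ffunE. Qed.

Lemma utility_complete (i : 'I_n) (p q : bundles n m) :
  q \in allocations n m j ->
  utility u i (complete p q) =
    utility u i q + \sum_(o in p i :\: first_items m j) u i o.
Proof.
move=> q_alloc; rewrite utility_split /utility !ffunE.
(* The part kept from [p] vanishes on the first [j] items and is unchanged off them; it remains to
   use that [q i] lies within those items. *)
rewrite setIUl setIDAC setDIl setDv setI0 setU0 setDUl setDDl setUid.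
have q_sub := allocations_sub i q_alloc.
by move/setIidPl: (q_sub) => ->; move: q_sub; rewrite -setD_eq0 => /eqP ->; rewrite set0U.
Qed.

Lemma pareto_efficient_restrict (p : bundles n m) :
  p \in allocations n m m -> pareto_efficient u m p ->
  pareto_efficient u j (restrict j p).
Proof.
move=> p_alloc; apply: contra => /exists_inP[q q_alloc /andP[q_ge q_gt]].
apply/exists_inP; exists (complete p q); first exact: complete_allocation.
apply/andP; split.
  (* Both sides carry the same sum over the late items of [p i], which cancels and leaves the
     comparison of [restrict j p] with [q]. *)
  apply/forallP => i; rewrite utility_split utility_complete // lerD2r.
  exact: (forallP q_ge).
case/existsP: q_gt => k q_gt; apply/existsP; exists k.
by rewrite utility_split utility_complete // ltrD2r.
Qed.

End Completion.

(** All utilities are empty sums, so nobody can strictly gain. This settles the case without a last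
    round. *)
Lemma pareto_efficient_no_items (R : realFieldType) (n : nat)
    (u : 'I_n -> 'I_0 -> R) (j : nat) (p : bundles n 0) :
  pareto_efficient u j p.
Proof.
apply/negP => /exists_inP[q _ /andP[_ /existsP[k]]].
by rewrite /utility !big_pred0 ?ltxx // => -[].
Qed.

Lemma round_prob_ge0 (R : realFieldType) (n m : nat) (u : 'I_n -> 'I_m -> R)
    (p : bundles n m) (o : 'I_m) (q : bundles n m) :
  0 <= round_prob u p o q.
Proof. by apply: sumr_ge0 => i _; rewrite invr_ge0 ler0n. Qed.

Lemma round_prob_gt0P (R : realFieldType) (n m : nat) (u : 'I_n -> 'I_m -> R)
    (p : bundles n m) (o : 'I_m) (q : bundles n m) :
  reflect (exists2 i, i \in feasible u p o & give p o i = q)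
          (0 < round_prob u p o q).
Proof.
apply: (iffP idP) => [prob_gt0|[i i_feas give_i]].
  case: (pickP [pred i in feasible u p o | give p o i == q]) => [i|none].
    by case/andP => i_feas /eqP give_i; exists i.
  by move: prob_gt0; rewrite /round_prob big_pred0 ?ltxx.
rewrite /round_prob (bigD1 i) /=; last by rewrite i_feas give_i eqxx.
apply: ltr_wpDr; first by apply: sumr_ge0 => k _; rewrite invr_ge0 ler0n.
(* The agent [i] itself witnesses that the feasible set is nonempty, so the inverse of its cardinal
   is not the default value 0. *)
by rewrite invr_gt0 ltr0n; apply/card_gt0P; exists i.
Qed.

Theorem theorem6 (R : realFieldType) (n m : nat) (u : 'I_n -> 'I_m -> R)
    (u_ge0 : forall (i : 'I_n) (o : 'I_m), 0 <= u i o)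
    (u_gt0 : forall o : 'I_m, exists i : 'I_n, 0 < u i o)
    (p : bundles n m) (p_alloc : p \in allocations n m m) :
  0 < pareto_like_prob u p <-> pareto_efficient u m p.
Proof.
clear u_ge0 u_gt0; split=> [|p_eff].
  case: m => [|m'] in u p p_alloc *; first by rewrite pareto_efficient_no_items.
  (* A nonzero product has nonzero factors; the one of the last item is enough. *)
  move=> /lt0r_neq0/prodf_neq0/(_ ord_max isT) last_neq0.
  have /round_prob_gt0P[i] : 0 < round_prob u (restrict m' p) ord_max (restrict m'.+1 p).
    by rewrite lt0r last_neq0 round_prob_ge0.
  (* The last item has index [m'], so feasibility in its round is efficiency over all [m'.+1] items,
     and restricting [p] to all of them gives [p] back. *)
  by rewrite inE => + give_i; rewrite give_i restrict_allocation.
apply: prodr_gt0 => o _; apply/round_prob_gt0P.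
have [_ p_cover] := allocationsP _ _ p_alloc.
(* The feasible receiver of [o] is its owner in [p]. *)
have : o \in \bigcup_(i < n) p i by rewrite p_cover inE.
case/bigcupP => i _ o_pi; have give_i := give_restrict p_alloc o_pi.
by exists i => //; rewrite inE give_i pareto_efficient_restrict.
Qed.
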